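(* Let $A^s$, $G$, the interior/exterior splitting, and the matrices $R$, $S_I$ be as described in the context, with $A^s_{II}=S_I^TA^sS_I$ invertible. Let $$P_{\mathrm{app}}=\bigl(I-S_I(A^s_{II})^{-1}S_I^TA^s\bigr)R^T$$ and let $G_c:=R\,G\,I_{\mathcal C}$ be the coarse gradient, where $I_{\mathcal C}$ is the injection matrix selecting the nonzero columns of $RG$. Then there exists a matrix (nodal interpolation operator) $P_n$ such that $$P_{\mathrm{app}}\,G_c=G\,P_n .$$
   Context: Setting (unshifted case $\beta=0$). $A^s\in\mathbb{R}^{n\times n}$ is symmetric positive semidefinite (the unshifted curl-curl stiffness matrix of a lowest-order Nédélec edge discretization, with rows and columns indexed by the oriented edge degrees of freedom). $G\in\mathbb{R}^{n\times m}$ is the discrete gradient from nodal to edge degrees of freedom: a signed incidence matrix with entries in $\{0,1,-1\}$, rows indexed by edges and columns by nodes. They satisfy the exactness relation $\ker(A^s)=\mathrm{range}(G)$. Interior/exterior splitting. The index set $\{1,\dots,n\}$ is a disjoint union $I\cup E$ (interior and exterior degrees of freedom), and $E$ is partitioned into disjoint pairs of edges $\{a,b\}$, the two edges of each pair meeting at a node associated with that pair. For each pair with associated node $k$, the $k$-th column of $G$ has nonzero entries $G_{ak},G_{bk}\in\{1,-1\}$, and its restriction to $E$ is supported exactly on $\{a,b\}$ (its entries on $I$ are unrestricted). Vectors are ordered with interior indices first, and $A^s$ is written in blocks $A^s_{II},A^s_{IE},A^s_{EI},A^s_{EE}$. Coarse and fine variables. $S_E\in\mathbb{R}^{|E|\times|E|/2}$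 has one column per pair, with entries $G_{ak}/\sqrt2$ at $a$, $G_{bk}/\sqrt2$ at $b$, and zero elsewhere. $R_E\in\mathbb{R}^{(|E|/2)\times|E|}$ has one row per pair, supported on $\{a,b\}$, of unit length with entries $\pm1/\sqrt2$, orthogonal to the corresponding column of $S_E$; thus $R_ER_E^T=I$ and $R_E^TR_E+S_ES_E^T=I$. Set $R=\begin{bmatrix}0&R_E\end{bmatrix}$. The $n\times|I|$ matrix $S_I$ consists of the Euclidean basis vectors $\{\mathbf e_i:i\in I\}$. Injection. $I_{\mathcal C}\in\mathbb{R}^{m\times m_c}$ is the submatrix of the $m\times m$ identity consisting of the columns $j$ for which the $j$-th column of $RG$ is nonzero; $m_c$ is their number, so $P_n\in\mathbb{R}^{m\times m_c}$. *)

(* Defs.v *)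
From HB Require Import structures.
From mathcomp Require Import all_boot all_order all_algebra.
From mathcomp Require Import reals.

Set Implicit Arguments.
Unset Strict Implicit.
Unset Printing Implicit Defensive.

Import Order.TTheory GRing.Theory Num.Theory.
Local Open Scope ring_scope.

(* Interior degrees of freedom come first: edge indices are 'I_(ni + ne), with
   I the range of lshift and E the range of rshift, so that the restriction to
   E of the rows of a matrix is its dsubmx. *)

Definition psd (R : realType) (n : nat) (A : 'M[R]_n) : Prop :=
  A^T = A /\ forall x : 'cV[R]_n, 0 <= (x^T *m A *m x) 0 0.

Definition kernel_eq_range (R : realType) (n m : nat)
    (A : 'M[R]_n) (G : 'M[R]_(n, m)) : Prop :=
  forall x : 'cV[R]_n, A *m x = 0 <-> exists y : 'cV[R]_m, x = G *m y.

(* Each edge (row) has at most one head (entry 1) and at most one tail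
   (entry -1); fewer than two nonzero entries are allowed because nodes may have
   been eliminated by essential boundary conditions. *)
Definition signed_incidence (R : realType) (n m : nat) (G : 'M[R]_(n, m)) : Prop :=
  [/\ forall i j, G i j \in [:: 0; 1; -1],
      forall i j j', G i j = 1 -> G i j' = 1 -> j = j'
    & forall i j j', G i j = -1 -> G i j' = -1 -> j = j'].

(* E is the disjoint union of the two-element sets {a k, b k}, k < p; in
   particular ne = 2 * p. *)
Definition edge_pairing (ne p : nat) (a b : 'I_p -> 'I_ne) : Prop :=
  bijective (fun k : 'I_p * bool => if k.2 then b k.1 else a k.1).

Definition pair_nodes (R : realType) (ni ne m p : nat) (G : 'M[R]_(ni + ne, m))
    (a b : 'I_p -> 'I_ne) (node : 'I_p -> 'I_m) : Prop :=
  forall (k : 'I_p) (e : 'I_ne),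
    (dsubmx G e (node k) != 0) = (e \in [:: a k; b k]).

Definition S_E (R : realType) (ni ne m p : nat) (G : 'M[R]_(ni + ne, m))
    (a b : 'I_p -> 'I_ne) (node : 'I_p -> 'I_m) : 'M[R]_(ne, p) :=
  \matrix_(e, k)
    if e \in [:: a k; b k] then dsubmx G e (node k) / Num.sqrt 2 else 0.

(* These conditions determine each row of RE only up to sign, hence a predicate
   rather than a definition of RE. *)
Definition coarse_rows (R : realType) (ni ne m p : nat) (G : 'M[R]_(ni + ne, m))
    (a b : 'I_p -> 'I_ne) (node : 'I_p -> 'I_m) (RE : 'M[R]_(p, ne)) : Prop :=
  forall k : 'I_p,
    [/\ forall e, e \in [:: a k; b k] ->
          RE k e \in [:: 1 / Num.sqrt 2; - (1 / Num.sqrt 2)],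
        forall e, e \notin [:: a k; b k] -> RE k e = 0,
        row k RE *m (row k RE)^T = 1%:M
      & row k RE *m col k (S_E G a b node) = 0].

Definition coarse_mx (R : realType) (ni ne p : nat) (RE : 'M[R]_(p, ne)) :
    'M[R]_(p, ni + ne) := row_mx 0 RE.

Definition S_I (R : realType) (ni ne : nat) : 'M[R]_(ni + ne, ni) :=
  col_mx 1%:M 0.
Arguments S_I : clear implicits.

Definition A_II (R : realType) (ni ne : nat) (A : 'M[R]_(ni + ne)) : 'M[R]_ni :=
  (S_I R ni ne)^T *m A *m S_I R ni ne.

Lemma A_II_ulsubmx (R : realType) (ni ne : nat) (A : 'M[R]_(ni + ne)) :
  A_II A = ulsubmx A.
Proof.
rewrite /A_II /S_I tr_col_mx trmx1 trmx0 -{1}[A]submxK mul_row_block.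
by rewrite mul_row_col !mul1mx !mul0mx mulmx1 mulmx0 !addr0.
Qed.

Definition P_app (R : realType) (ni ne p : nat) (A : 'M[R]_(ni + ne))
    (RE : 'M[R]_(p, ne)) : 'M[R]_(ni + ne, p) :=
  (1%:M - S_I R ni ne *m invmx (A_II A) *m (S_I R ni ne)^T *m A)
    *m (coarse_mx ni RE)^T.

Definition nz_cols (R : realType) (p m : nat) (M : 'M[R]_(p, m)) : {set 'I_m} :=
  [set j | col j M != 0].

Definition injection_mx (R : realType) (p m : nat) (M : 'M[R]_(p, m)) :
    'M[R]_(m, #|nz_cols M|) :=
  colsub (fun i => enum_val i) 1%:M.

Definition G_c (R : realType) (ni ne m p : nat) (G : 'M[R]_(ni + ne, m))
    (RE : 'M[R]_(p, ne)) : 'M[R]_(p, #|nz_cols (coarse_mx ni RE *m G)|) :=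
  coarse_mx ni RE *m G *m injection_mx (coarse_mx ni RE *m G).

(* Main.v *)
(* Write [Pi] for [I - S_I (A_II)^-1 S_I^T A].  It annihilates [S_I] and, since
   [A G = 0], fixes the range of [G].  From [R_E^T R_E = I - S_E S_E^T] and the
   fact that [S_E] consists of the exterior rows of the pair node columns of [G],
   scaled by [1 / sqrt 2], one gets [R^T R G = G X + S_I Y] for explicit [X] and
   [Y]; hence [Pi R^T R G = G X]. *)
Require Import Defs.
From mathcomp Require Import all_boot all_order all_algebra.
From mathcomp Require Import reals.

Set Implicit Arguments.
Unset Strict Implicit.
Unset Printing Implicit Defensive.

Import Order.TTheory GRing.Theory Num.Theory.
Local Open Scope ring_scope.

(** Meant for the dimensions [p + p] and [ne], which are provably equal but not convertible;
    substituting one for the other gives the square case. *)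
Lemma mulmx1C_eq_dim (F : comUnitRingType) (m n : nat) (B : 'M[F]_(m, n))
    (C : 'M[F]_(n, m)) : m = n -> B *m C = 1%:M -> C *m B = 1%:M.
Proof. by move=> mn; subst m => /mulmx1C. Qed.

Lemma edge_pairing_card (ne p : nat) (a b : 'I_p -> 'I_ne) :
  edge_pairing a b -> (p + p)%N = ne.
Proof.
by move=> /bij_eq_card; rewrite card_prod card_bool !card_ord muln2 addnn.
Qed.

Lemma edge_pairing_neq (ne p : nat) (a b : 'I_p -> 'I_ne) (k : 'I_p) :
  edge_pairing a b -> a k != b k.
Proof.
by move=> /bij_inj inj; apply/eqP => ab; have := inj (k, false) (k, true) ab.
Qed.

Lemma edge_pairing_disjoint (ne p : nat) (a b : 'I_p -> 'I_ne)
    (k l : 'I_p) (e : 'I_ne) :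
  edge_pairing a b -> e \in [:: a k; b k] -> e \in [:: a l; b l] -> k = l.
Proof.
move=> /bij_inj inj; rewrite !inE => /orP[] /eqP -> /orP[] /eqP E.
- by have [] := inj (k, false) (l, false) E.
- by have [] := inj (k, false) (l, true) E.
- by have [] := inj (k, true) (l, false) E.
- by have [] := inj (k, true) (l, true) E.
Qed.

(** Distinct pairs are disjoint, so each term of an off-diagonal entry has a zero factor and only
    the diagonal is left to compute. This yields all orthogonality relations among the rows of [RE]
    and the columns of [S_E]. *)
Lemma mulmx_pair_supported (F : pzRingType) (ne p : nat) (a b : 'I_p -> 'I_ne)
    (B : 'M[F]_(p, ne)) (C : 'M[F]_(ne, p)) (c : F) :
  edge_pairing a b ->
  (forall k e, e \notin [:: a k; b k] -> B k e = 0) ->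
  (forall k e, e \notin [:: a k; b k] -> C e k = 0) ->
  (forall k, (B *m C) k k = c) ->
  B *m C = c%:M.
Proof.
move=> pairing B0 C0 diag; apply/matrixP => k l; rewrite [RHS]mxE.
have [<-|kl] := eqVneq k l; first by rewrite diag.
rewrite mxE big1 // => e _.
have [ek|/B0 ->] := boolP (e \in [:: a k; b k]); last by rewrite mul0r.
have [el|/C0 ->] := boolP (e \in [:: a l; b l]); last by rewrite mulr0.
by rewrite (edge_pairing_disjoint pairing ek el) eqxx in kl.
Qed.

(** A node column already vanishes on the exterior edges off its pair, so the case split in [S_E]
    changes nothing. This ties the fine variables to discrete gradients. *)
Lemma S_E_colsub (R : realType) (ni ne m p : nat) (G : 'M[R]_(ni + ne, m))
    (a b : 'I_p -> 'I_ne) (node : 'I_p -> 'I_m) :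
  pair_nodes G a b node ->
  S_E G a b node = (Num.sqrt 2)^-1 *: dsubmx (colsub node G).
Proof.
move=> nodes; apply/matrixP => e k; rewrite !mxE; case: ifP => He.
  by rewrite mulrC.
by move: (nodes k e); rewrite He => /negbFE/eqP; rewrite mxE => ->; rewrite mulr0.
Qed.

Lemma S_E_orthonormal (R : realType) (ni ne m p : nat) (G : 'M[R]_(ni + ne, m))
    (a b : 'I_p -> 'I_ne) (node : 'I_p -> 'I_m) :
  signed_incidence G -> edge_pairing a b -> pair_nodes G a b node ->
  (S_E G a b node)^T *m S_E G a b node = 1%:M.
Proof.
move=> [G01 _ _] pairing nodes; apply: (mulmx_pair_supported pairing).
- by move=> k e /negPf He; rewrite !mxE He.
- by move=> k e /negPf He; rewrite !mxE He.
move=> k.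
have term e : e \in [:: a k; b k] -> (S_E G a b node e k) ^+ 2 = 2^-1.
  move=> He; rewrite mxE He expr_div_n sqr_sqrtr ?ler0n //.
  (* The value 0 is ruled out because the node column is nonzero on its pair; 1 and -1 have the same
     square. *)
  move: (nodes k e); rewrite He mxE.
  have := G01 (rshift ni e) (node k); rewrite !inE => /or3P[] /eqP ->.
  - by rewrite eqxx.
  - by rewrite expr1n div1r.
  - by rewrite sqrrN expr1n div1r.
have ab := edge_pairing_neq k pairing.
rewrite mxE (bigD1 (a k)) //= (bigD1 (b k)) 1?eq_sym //= big1 => [|e /andP[ea eb]].
  by rewrite ![_^T _ _]mxE -!expr2 !term ?inE ?eqxx ?orbT // addr0 -[2^-1]div1r -splitr.
by rewrite !mxE !inE (negPf ea) (negPf eb) mulr0.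
Qed.

Lemma coarse_fine_resolution (R : realType) (ni ne m p : nat)
    (G : 'M[R]_(ni + ne, m)) (a b : 'I_p -> 'I_ne) (node : 'I_p -> 'I_m)
    (RE : 'M[R]_(p, ne)) :
  signed_incidence G -> edge_pairing a b -> pair_nodes G a b node ->
  coarse_rows G a b node RE ->
  RE^T *m RE + S_E G a b node *m (S_E G a b node)^T = 1%:M.
Proof.
move=> incidence pairing nodes rows; set S := S_E G a b node.
have RE0 k e : e \notin [:: a k; b k] -> RE k e = 0.
  by have [_ + _ _] := rows k; apply.
have S0 k e : e \notin [:: a k; b k] -> S e k = 0.
  by move=> /negPf He; rewrite mxE He.
have RRT : RE *m RE^T = 1%:M.
  apply: (mulmx_pair_supported pairing RE0) => [k e /RE0|k]; first by rewrite mxE.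
  have [_ _ /matrixP/(_ 0 0) + _] := rows k.
  rewrite [1%:M _ _]mxE eqxx mulr1n => <-.
  by rewrite !mxE; apply: eq_bigr => e _; rewrite !mxE.
have RS : RE *m S = 0.
  (* Zero is read as a scalar matrix, so that the argument on pairs applies with [c = 0]. *)
  rewrite -[RHS](raddf0 (@scalar_mx R p)).
  apply: (mulmx_pair_supported pairing RE0 S0) => k.
  have [_ _ _ /matrixP/(_ 0 0)] := rows k; rewrite [RHS]mxE => <-.
  by rewrite !mxE; apply: eq_bigr => e _; rewrite !mxE.
have STS : S^T *m S = 1%:M by apply: S_E_orthonormal.
(* [col_mx RE S^T] is square because [ne = 2 p], so its orthonormal rows make it
   orthogonal. *)
have : row_mx RE^T S *m col_mx RE S^T = 1%:M.
  apply: (mulmx1C_eq_dim (edge_pairing_card pairing)).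
  rewrite mul_col_row RRT RS STS -(trmxK (S^T *m RE^T)) trmx_mul !trmxK RS trmx0.
  by rewrite -scalar_mx_block.
by rewrite mul_row_col.
Qed.

Lemma kernel_eq_range_mul0 (R : realType) (n m : nat) (A : 'M[R]_n)
    (G : 'M[R]_(n, m)) : kernel_eq_range A G -> A *m G = 0.
Proof.
move=> exact; apply/matrixP => i j.
have /matrixP/(_ i 0) : A *m col j G = 0.
  by apply/exact; exists (delta_mx j 0); rewrite -colE.
by rewrite colE mulmxA -colE !mxE.
Qed.

(** Extending the exterior part by zero costs only a term in the range of [S_I], which the
    projection in [P_app] annihilates once [A_II] is invertible. *)
Lemma col_mx0_dsubmx (R : realType) (ni ne q : nat) (B : 'M[R]_(ni + ne, q)) :
  col_mx 0 (dsubmx B) = B - S_I R ni ne *m usubmx B.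
Proof.
rewrite -[B in RHS]vsubmxK /S_I mul_col_mx mul1mx mul0mx opp_col_mx add_col_mx.
by rewrite col_mxKu subrr subr0.
Qed.

Theorem theorem3p3 (R : realType) (ni ne m p : nat)
    (A : 'M[R]_(ni + ne)) (G : 'M[R]_(ni + ne, m))
    (a b : 'I_p -> 'I_ne) (node : 'I_p -> 'I_m) (RE : 'M[R]_(p, ne))
    (A_psd : psd A)
    (G_incidence : signed_incidence G)
    (exactness : kernel_eq_range A G)
    (ab_pairing : edge_pairing a b)
    (ab_nodes : pair_nodes G a b node)
    (RE_rows : coarse_rows G a b node RE)
    (AII_unit : A_II A \in unitmx) :
  exists P_n : 'M[R]_(m, #|nz_cols (coarse_mx ni RE *m G)|),
    P_app A RE *m G_c G RE = G *m P_n.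
Proof.
(* [G *m N] consists of the pair node columns. Of the two factors [1 / sqrt 2] in [S *m S^T], one
   turns [S] into these columns and the other goes into [W]. [Y] collects the interior rows of
   [G *m N *m W - G]. *)
set S := S_E G a b node; set N : 'M[R]_(m, p) := colsub node 1%:M.
set W : 'M[R]_(p, m) := (Num.sqrt 2)^-1 *: (S^T *m dsubmx G).
pose X : 'M[R]_m := 1%:M - N *m W.
pose Y := usubmx (colsub node G) *m W - usubmx G.
have GN : G *m N = colsub node G by rewrite /N mulmx_colsub mulmx1.
have split_RTRG : (coarse_mx ni RE)^T *m (coarse_mx ni RE *m G)
    = G *m X + S_I R ni ne *m Y.
  rewrite /coarse_mx tr_row_mx trmx0 -{1}[G]vsubmxK mul_row_col mul0mx add0r.
  rewrite mul_col_mx mul0mx mulmxA.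
  have -> : RE^T *m RE = 1%:M - S *m S^T.
    by rewrite -(coarse_fine_resolution G_incidence ab_pairing ab_nodes RE_rows) addrK.
  have SW : S *m S^T *m dsubmx G = dsubmx (colsub node G) *m W.
    by rewrite -mulmxA {1}/S S_E_colsub // -scalemxAl /W -scalemxAr.
  (* The zero upper block is written as [0 - 0 *m W], so that the whole column splits into two zero
     extensions, of [G] and of [G *m N]. *)
  rewrite mulmxBl mul1mx SW -[X in col_mx X _](subr0 0) -[X in col_mx (_ - X) _](mul0mx _ W).
  rewrite -add_col_mx -opp_col_mx -mul_col_mx !col_mx0_dsubmx.
  rewrite /X /Y !mulmxBr mulmx1 mulmxA GN mulmxBl !mulmxA !opprB.
  by rewrite addrACA [RHS]addrACA; congr (_ + _); rewrite addrC.
(* The injection is a right factor of both sides, so it suffices to compare the left factors. *)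
exists (X *m injection_mx (coarse_mx ni RE *m G)).
rewrite /P_app /G_c mulmxA [RHS]mulmxA; congr (_ *m _).
rewrite -(mulmxA _ (coarse_mx ni RE)^T) split_RTRG.
rewrite mulmxDr !mulmxBl !mul1mx -!mulmxA (mulmxA A G).
rewrite (kernel_eq_range_mul0 exactness) mul0mx !mulmx0 subr0.
(* On [S_I *m Y] the correction term meets [A_II] next to its inverse and returns [S_I *m Y]
   itself. *)
have -> : (S_I R ni ne)^T *m (A *m (S_I R ni ne *m Y)) = A_II A *m Y.
  by rewrite /A_II !mulmxA.
by rewrite mulKmx // subrr addr0.
Qed.
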